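(* Let $G$ be an extraspecial $2$-group of order $2^{2n+1}$ with center $Z=\{1,z\}$, let $S\subseteq G\setminus\{1\}$ be an admissible connecting set with associated integers $\ell$ and $e_y$, $y\in(\mathbb{Z}/2\mathbb{Z})^{2n}$ (see context), and let $X=\mathrm{Cay}(G,S)$ be the normal Cayley graph with connecting set $S$. Then $X$ is integral, and its spectrum is (the multiset): $$\mathrm{Spec}(X)=\{4e_y-2\ell+1: y\in(\mathbb{Z}/2\mathbb{Z})^{2n}\}\cup\{-1\}\quad\text{when } z\in S,$$ and $$\mathrm{Spec}(X)=\{4e_y-2\ell: y\in(\mathbb{Z}/2\mathbb{Z})^{2n}\}\cup\{0\}\quad\text{when } z\notin S.$$
   Context: An extraspecial $2$-group is a finite $2$-group $G$ whose center $Z$ has order $2$ and such that $G/Z\cong(\mathbb{Z}/2\mathbb{Z})^m$ for some $m\ge1$; its order is $2^{2n+1}$ for some $n\ge 1$. Let $z$ be the unique central involution, fix an isomorphism $G/Z\cong(\mathbb{Z}/2\mathbb{Z})^{2n}$, and write $\bar g$ for the image of $g\in G$ in $(\mathbb{Z}/2\mathbb{Z})^{2n}$. The conjugacy classes of noncentral elements are the cosets $K(x)=\{x,xz\}$, of size $2$. Admissible connecting set: $S\subseteq G\setminus\{1\}$ is a union of conjugacy classes of $G$ (hence closed under inverses), $S$ generates $G$, and $S\ne G\setminus\{1\}$. Write $S\setminus\{z\}=K(x_1)\cup\cdots\cup K(x_\ell)$ with distinct size-$2$ conjugacy classes $K(x_i)$ of elements $x_i\in G$ (the element $z$ may or may not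 be in $S$); this defines $\ell$. For $y\in(\mathbb{Z}/2\mathbb{Z})^{2n}$, $e_y$ is the number of elements $x_i$, $i\in\{1,\dots,\ell\}$, with $y\cdot\bar x_i=0$ modulo $2$ (standard dot product). $\mathrm{Cay}(G,S)$ is the graph with vertex set $G$ in which $g,h$ are adjacent iff $gh^{-1}\in S$; it is called normal because $S$ is a union of conjugacy classes. $\mathrm{Spec}(X)$ denotes the spectrum of the adjacency matrix of $X$, and a graph is integral if all eigenvalues of its adjacency matrix are integers.
   Formalization: As a multiset, the family over y together with a single -1 (resp. 0) has only 2^(2n)+1 elements, while Spec(X) has 2^(2n+1); the formal statement gives the extra eigenvalue -1 (resp. 0) multiplicity 2^(2n). *)

(* Defs.v *)
From mathcomp Require Import all_boot all_order all_algebra.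
From mathcomp Require Import all_fingroup all_solvable all_field.

Set Implicit Arguments.
Unset Strict Implicit.
Unset Printing Implicit Defensive.

Import GRing.Theory Num.Theory.

Local Open Scope ring_scope.

(* A graph is given by its adjacency relation on a finite vertex type; the
   spectrum of its adjacency matrix is taken in algC. *)
Definition adjmx (V : finType) (e : rel V) : 'M[algC]_#|V| :=
  \matrix_(i, j) (e (enum_val i) (enum_val j))%:R.

(* The roots in algC of the characteristic polynomial, with multiplicity, in an
   unspecified order: to be compared only up to perm_eq. *)
Definition spectrum (n : nat) (A : 'M[algC]_n) : seq algC :=
  sval (closed_field_poly_normal (char_poly A)).

Definition graph_spectrum (V : finType) (e : rel V) : seq algC :=
  spectrum (adjmx e).

Definition integral_graph (V : finType) (e : rel V) : Prop :=
  forall a : algC, eigenvalue (adjmx e) a -> a \is a Num.int.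

Definition Cay (gT : finGroupType) (G : {group gT}) (S : {set gT}) :
    rel (subg_of G) :=
  fun g h => (sgval g * (sgval h)^-1)%g \in S.
Arguments Cay {gT} G S.

Definition union_of_classes (gT : finGroupType) (G : {group gT})
    (S : {set gT}) : Prop :=
  exists2 C : {set {set gT}}, C \subset classes G & S = cover C.

Definition admissible (gT : finGroupType) (G : {group gT})
    (S : {set gT}) : Prop :=
  [/\ S \subset (G^#)%g, union_of_classes G S, <<S>>%g = G
    & S != (G^#)%g].

(* x lists one element of each of the l distinct classes K(x_i), all of
   size 2, whose union is S :\ z. *)
Definition class_reps (gT : finGroupType) (G : {group gT}) (S : {set gT})
    (z : gT) (l : nat) (x : 'I_l -> gT) : Prop :=
  [/\ forall i, x i \in G,
      forall i, #|(x i ^: G)%g| = 2%N,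
      injective (fun i => (x i ^: G)%g)
    & S :\ z = \bigcup_(i < l) (x i ^: G)%g].

Definition dot (R : pzSemiRingType) (m : nat) (u v : 'rV[R]_m) : R :=
  \sum_(i < m) u 0 i * v 0 i.

(* The isomorphism phi fixes the coordinates: the image of g in (Z/2)^m is
   phi (coset 'Z(G) g). *)
Definition e_count (gT : finGroupType) (G : {group gT}) (m : nat)
    (phi : coset_of 'Z(G) -> 'rV['F_2]_m) (l : nat) (x : 'I_l -> gT)
    (y : 'rV['F_2]_m) : nat :=
  #|[set i : 'I_l | dot y (phi (coset 'Z(G) (x i))) == 0]|.

(* Main.v *)
Require Import Defs.
From mathcomp Require Import all_boot all_order all_algebra.
From mathcomp Require Import all_fingroup all_solvable all_field.

Set Implicit Arguments.
Unset Strict Implicit.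
Unset Printing Implicit Defensive.

Import GRing.Theory Num.Theory.

Local Open Scope ring_scope.

(* The 2^(2n) functions chi_y : g |-> (-1)^(y . gbar) are linear characters of G,
   hence eigenvectors of the Cayley graph, with eigenvalue the sum of chi_y
   over S; each class {x_i, x_i z} contributes 2 chi_y(x_i).  The remaining
   eigenvectors are the functions f with f (z g) = - f g: as S :\ z is invariant
   under multiplication by z, its contribution cancels and only z acts, by -1.
   A basis of these is eps * chi_y, where eps is a sign with
   eps (z g) = - eps g; all these functions together are orthogonal. *)

(** * Characteristic polynomials and spectra *)

(** Since [P (X - A) = (X - B) P] over polynomials, taking determinants and cancelling the nonzero
    constant [\det P] suffices. *)
Lemma char_poly_intertwine (R : idomainType) (m : nat) (P A B : 'M[R]_m) :
  \det P != 0 -> P *m A = B *m P -> char_poly A = char_poly B.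
Proof.
move=> detP0 PA_BP; have detP_poly: \det (map_mx polyC P) != 0.
  by rewrite det_map_mx polyC_eq0.
apply: (mulfI detP_poly); rewrite /char_poly -det_mulmx mulrC -det_mulmx.
congr (\det _); rewrite /char_poly_mx mulmxBr mulmxBl -!map_mxM PA_BP.
by rewrite scalar_mxC.
Qed.

Lemma perm_spectrum (m : nat) (A : 'M[algC]_m) (s : seq algC) :
  char_poly A = \prod_(a <- s) ('X - a%:P) -> perm_eq (spectrum A) s.
Proof.
move=> charA; rewrite /spectrum; case: closed_field_poly_normal => r /= charA_r.
apply: prod_XsubC_eq.
by rewrite -charA charA_r (monicP (char_poly_monic A)) scale1r.
Qed.

Lemma mem_spectrum (m : nat) (A : 'M[algC]_m) (a : algC) :
  eigenvalue A a = (a \in spectrum A).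
Proof.
rewrite eigenvalue_root_char /spectrum.
case: closed_field_poly_normal => r /= ->.
by rewrite (monicP (char_poly_monic A)) scale1r root_prod_XsubC.
Qed.

(** The matrix [P] with rows [w i] is square by the cardinality hypothesis. Orthogonality reads
    [P P^T = c], so [\det P] is nonzero, and [P] intertwines the adjacency matrix with the diagonal
    matrix of the [a i]. The pairing has no conjugation, which suits functions with values 1 and
    -1. *)
Lemma spectrum_orthogonal_eigenbasis (V I : finType) (e : rel V)
    (w : I -> V -> algC) (a : I -> algC) (c : algC) :
  #|I| = #|V| -> c != 0 ->
  (forall i j, \sum_v w i v * w j v = c *+ (i == j)) ->
  (forall i v, \sum_u w i u * (e u v)%:R = a i * w i v) ->
  perm_eq (graph_spectrum e) [seq a i | i <- enum I].
Proof.
move=> cardI c0 ortho eigen; pose f k := enum_val (cast_ord (esym cardI) k).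
have f_inj: injective f by move=> i j /enum_val_inj/cast_ord_inj.
pose P := \matrix_(k < #|V|, j < #|V|) w (f k) (enum_val j).
have PPt: P *m P^T = c%:M.
  apply/matrixP=> i j; rewrite !mxE -(inj_eq f_inj) -ortho.
  rewrite (reindex _ (onW_bij _ (enum_val_bij V))).
  by apply: eq_bigr => k _; rewrite !mxE.
have detP0: \det P != 0.
  apply: contra_neq c0 => detP0; move/(congr1 determinant)/eqP: PPt.
  rewrite det_mulmx detP0 mul0r det_scalar eq_sym expf_eq0.
  by case/andP=> _ /eqP.
pose D := diag_mx (\row_(k < #|V|) a (f k)).
have PA_DP: P *m adjmx e = D *m P.
  apply/matrixP=> i j; rewrite mul_diag_mx !mxE -eigen.
  rewrite (reindex _ (onW_bij _ (enum_val_bij V))).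
  by apply: eq_bigr => k _; rewrite !mxE.
apply: perm_spectrum; rewrite (char_poly_intertwine detP0 PA_DP).
rewrite char_poly_trig ?diag_mx_is_trig // big_map big_enum.
rewrite [RHS](reindex f) /=; last first.
  apply: onW_bij; apply: inj_card_bij => //.
  by rewrite cardI card_ord.
by apply: eq_bigr => k _; rewrite !mxE eqxx mulr1n.
Qed.

(** * The nontrivial character of ['F_2], and the dot product *)

Definition sgF2 (a : 'F_2) : algC := (-1) ^+ (a != 0).

Lemma sgF2D (a b : 'F_2) : sgF2 (a + b) = sgF2 a * sgF2 b.
Proof.
by case: a b => [[|[|[]]] // ?] [[|[|[]]] // ?];
  rewrite /sgF2 -signr_addb; congr ((-1) ^+ _).
Qed.

Lemma sgF2_sqr (a : 'F_2) : sgF2 a * sgF2 a = 1.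
Proof. by rewrite -expr2 sqrr_sign. Qed.

Lemma sgF2_neq (a b : 'F_2) : a != b -> sgF2 a * sgF2 b = -1.
Proof.
by case: a b => [[|[|[]]] // ?] [[|[|[]]] // ?]; rewrite /sgF2 ?mulr1 ?mul1r.
Qed.

(** This form turns a sum of signs into a count of zeros, which is how [e_count] enters. *)
Lemma sgF2E (a : 'F_2) : sgF2 a = 2 * (a == 0)%:R - 1.
Proof.
rewrite /sgF2; case: (a == 0); rewrite ?mulr1 ?mulr0 ?sub0r //.
by rewrite -[2]/(1 + 1) addrK.
Qed.

Lemma dotBl (R : pzRingType) (m : nat) (u v w : 'rV[R]_m) :
  dot (u - v) w = dot u w - dot v w.
Proof. by rewrite -sumrB; apply: eq_bigr => i _; rewrite !mxE mulrBl. Qed.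

Lemma dotDr (R : pzSemiRingType) (m : nat) (u v w : 'rV[R]_m) :
  dot u (v + w) = dot u v + dot u w.
Proof. by rewrite -big_split; apply: eq_bigr => i _; rewrite mxE mulrDr. Qed.

Lemma dot0r (R : pzSemiRingType) (m : nat) (u : 'rV[R]_m) : dot u 0 = 0.
Proof. by apply: big1 => i _; rewrite mxE mulr0. Qed.

Lemma dot_nondegenerate (R : pzSemiRingType) (m : nat) (u : 'rV[R]_m) :
  u != 0 -> exists v, dot u v != 0.
Proof.
case/rV0Pn=> i ui0; exists (delta_mx 0 i).
rewrite /dot (bigD1 i) //= big1 ?addr0 => [|j jNi]; rewrite mxE eqxx.
  by rewrite eqxx mulr1.
by rewrite (negPf jNi) mulr0.
Qed.

(** * Sums over the group and its classes *)

(** Reindexing by [h] shows that the sum is its own opposite. This gives both the orthogonality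
    relations and the cancellation over [S :\ z]. *)
Lemma sum_antisym (T : finType) (A : {pred T}) (h : T -> T) (F : T -> algC) :
  injective h -> (forall g, (h g \in A) = (g \in A)) ->
  {in A, forall g, F (h g) = - F g} -> \sum_(g in A) F g = 0.
Proof.
move=> h_inj hA hF; set s := \sum_(g in A) _; suff /eqP: s = - s.
  by rewrite -addr_eq0 -mulr2n mulrn_eq0 => /eqP.
rewrite {1}/s (reindex_inj h_inj) (eq_bigl (mem A)) // -sumrN.
exact: eq_bigr.
Qed.

Lemma sum_subg (gT : finGroupType) (G : {group gT}) (F : gT -> algC) :
  \sum_(u : subg_of G) F (sgval u) = \sum_(g in G) F g.
Proof.
rewrite [RHS](reindex_onto sgval (subg G)) => [|g Gg]; last by rewrite subgK.
by apply: eq_bigl => u; rewrite subgP sgvalK eqxx.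
Qed.

(** Substitute [u = s * v]: adjacency of [u] and [v] becomes [s \in S]. *)
Lemma sum_Cay (gT : finGroupType) (G : {group gT}) (S : {set gT})
    (w : gT -> algC) (v : subg_of G) :
  S \subset G ->
  \sum_(u : subg_of G) w (sgval u) * (Cay G S u v)%:R =
  \sum_(s in S) w (s * sgval v)%g.
Proof.
move=> sSG.
rewrite (sum_subg _ (fun g => w g * ((g * (sgval v)^-1)%g \in S)%:R)).
rewrite (reindex_inj (mulIg (sgval v))) /= [RHS]big_mkcond /= big_mkcond /=.
apply: eq_bigr => s _; rewrite groupMr ?subgP // mulgK.
have [Ss | _] := boolP (s \in S); last by rewrite mulr0 if_same.
by rewrite (subsetP sSG _ Ss) mulr1.
Qed.

(** Each quotient [x ^ g * x^-1] is a commutator, hence central, so the class lies in the coset;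
    equal cardinalities then force equality. *)
Lemma class_central_rcoset (gT : finGroupType) (G : {group gT}) (x : gT) :
  (G^`(1) \subset 'Z(G))%g -> #|(x ^: G)%g| = #|('Z(G))%g| -> x \in G ->
  (x ^: G = 'Z(G) :* x)%g.
Proof.
move=> sG'Z card_xG Gx; apply/eqP; rewrite eqEcard card_rcoset card_xG leqnn.
rewrite andbT; apply/subsetP=> _ /imsetP[g Gg ->].
rewrite mem_rcoset (subsetP sG'Z) //.
have ->: (x ^ g * x^-1 = [~ g, x^-1])%g by rewrite commgEl /conjg invgK !mulgA.
by rewrite mem_commg ?groupV.
Qed.

(** * The linear characters and the antisymmetric sign *)

Definition chi (gT : finGroupType) (G : {group gT}) (m : nat)
    (phi : coset_of 'Z(G) -> 'rV['F_2]_m) (y : 'rV['F_2]_m) (g : gT) : algC :=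
  sgF2 (dot y (phi (coset 'Z(G) g))).

Lemma chi_sqr (gT : finGroupType) (G : {group gT}) (m : nat)
    (phi : coset_of 'Z(G) -> 'rV['F_2]_m) (y : 'rV['F_2]_m) (g : gT) :
  chi phi y g * chi phi y g = 1.
Proof. exact: sgF2_sqr. Qed.

Lemma chiM (gT : finGroupType) (G : {group gT}) (m : nat)
    (phi : {morphism (G / 'Z(G))%g >-> 'rV['F_2]_m}) (y : 'rV['F_2]_m) :
  {in G &, {morph chi phi y : g h / (g * h)%g >-> g * h}}.
Proof.
have nZ: (G \subset 'N('Z(G)))%g by apply: gFnorm.
move=> g h Gg Gh; rewrite /chi morphM ?(subsetP nZ) //.
by rewrite morphM ?mem_quotient // FinRing.zmodMgE dotDr sgF2D.
Qed.

Lemma chi_center (gT : finGroupType) (G : {group gT}) (m : nat)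
    (phi : {morphism (G / 'Z(G))%g >-> 'rV['F_2]_m}) (y : 'rV['F_2]_m) (g : gT) :
  g \in 'Z(G)%g -> chi phi y g = 1.
Proof.
move=> Zg; rewrite /chi coset_id // morph1 FinRing.zmod1gE dot0r.
by rewrite /sgF2 eqxx.
Qed.

Lemma chiJ (gT : finGroupType) (G : {group gT}) (m : nat)
    (phi : {morphism (G / 'Z(G))%g >-> 'rV['F_2]_m}) (y : 'rV['F_2]_m) (g h : gT) :
  g \in G -> h \in (g ^: G)%g -> chi phi y h = chi phi y g.
Proof.
(* The value 1 at the identity, written as [k^-1 * k], shows that the factors at [k^-1] and [k]
   cancel. *)
move=> Gg /imsetP[k Gk ->]; have := chi_center phi y (group1 'Z(G)).
rewrite -(mulVg k) /conjg !chiM ?groupM ?groupV // => chi1.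
by rewrite mulrCA chi1 mulr1.
Qed.

(** Nondegeneracy gives a vector whose products with [y1] and [y2] differ; surjectivity of [phi]
    lifts it to [G]. *)
Lemma chi_separates (gT : finGroupType) (G : {group gT}) (m : nat)
    (phi : {morphism (G / 'Z(G))%g >-> 'rV['F_2]_m}) (y1 y2 : 'rV['F_2]_m) :
  (phi @* (G / 'Z(G)) = [set: 'rV['F_2]_m])%g -> y1 != y2 ->
  exists2 g, g \in G & chi phi y1 g * chi phi y2 g = -1.
Proof.
move=> im_phi; rewrite -subr_eq0 => /dot_nondegenerate[v].
rewrite dotBl subr_eq0 => y12v.
have: v \in (phi @* (G / 'Z(G)))%g by rewrite im_phi inE.
case/morphimP=> _ _ /morphimP[g _ Gg ->] def_v.
by exists g => //; rewrite /chi -def_v sgF2_neq.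
Qed.

(** The sign is +1 on the chosen representative of each central coset and -1 elsewhere. It depends
    on that choice and need not be multiplicative. *)
Definition eps (gT : finGroupType) (G : {group gT}) (g : gT) : algC :=
  (-1) ^+ (repr ('Z(G) :* g)%g != g).

Lemma eps_sqr (gT : finGroupType) (G : {group gT}) (g : gT) :
  eps G g * eps G g = 1.
Proof. by rewrite -expr2 sqrr_sign. Qed.

(** Both [g] and [z * g] lie in one two-element coset, and exactly one of them is its
    representative. *)
Lemma eps_antisym (gT : finGroupType) (G : {group gT}) (z g : gT) :
  z != 1%g -> 'Z(G)%g = [set 1%g; z] -> eps G (z * g)%g = - eps G g.
Proof.
move=> z1 defZ; have Zz: z \in 'Z(G)%g by rewrite defZ set22.
rewrite /eps rcosetM rcoset_id //.
have /rcosetP[u Zu ->] := mem_repr_rcoset 'Z(G) g.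
have mulIeq a b : (a * g == b * g)%g = (a == b) by apply: inj_eq (mulIg g) _ _.
have ->: (u * g == g)%g = (u == 1%g) by rewrite -{2}(mul1g g) mulIeq.
rewrite mulIeq; have /set2P[->|->]: u \in [set 1%g; z] by rewrite -defZ.
  by rewrite eqxx eq_sym z1 expr0 expr1.
by rewrite eqxx z1 expr0 expr1 opprK.
Qed.

Theorem theorem3p1 (gT : finGroupType) (G : {group gT}) (n : nat) (z : gT)
    (phi : {morphism (G / 'Z(G))%g >-> 'rV['F_2]_(2 * n)})
    (S : {set gT}) (l : nat) (x : 'I_l -> gT)
    (G_2group : (2.-group G)%g)
    (G_extraspecial : extraspecial G)
    (G_order : #|G| = (2 ^ (2 * n + 1))%N)
    (Z_def : 'Z(G)%g = [set 1%g; z])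
    (phi_isom : isom (G / 'Z(G))%g [set: 'rV['F_2]_(2 * n)] phi)
    (S_admissible : admissible G S)
    (x_reps : class_reps G S z x) :
  integral_graph (Cay G S) /\
  (z \in S ->
    perm_eq (graph_spectrum (Cay G S))
      ([seq 4 * (e_count phi x y)%:R - 2 * l%:R + 1
         | y <- enum {: 'rV['F_2]_(2 * n)}]
       ++ nseq (2 ^ (2 * n)) (-1))) /\
  (z \notin S ->
    perm_eq (graph_spectrum (Cay G S))
      ([seq 4 * (e_count phi x y)%:R - 2 * l%:R
         | y <- enum {: 'rV['F_2]_(2 * n)}]
       ++ nseq (2 ^ (2 * n)) 0)).
Proof.
case: G_extraspecial => -[_ derG] prZ.
have cardZ: #|'Z(G)%g| = 2.
  by apply/eqP; rewrite eqn_leq prime_gt1 // Z_def cards2; case: (_ != _).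
(* If [z] were 1, the center would have order 1, which is not prime. *)
have z1: z != 1%g.
  by apply: contraL prZ => /eqP z_1; rewrite Z_def z_1 setUid cards1.
have Zz: z \in 'Z(G)%g by rewrite Z_def set22.
have Gz: z \in G by apply: subsetP Zz; apply: center_sub.
have [sSG1 _ _ _] := S_admissible.
have sSG: S \subset G by apply: subset_trans sSG1 (subD1set _ _).
have [Gx card_xG xG_inj defS] := x_reps.
have xG_Z i: (x i ^: G = 'Z(G) :* x i)%g.
  by apply: class_central_rcoset; rewrite ?derG ?card_xG ?cardZ.
(* A union of cosets of the center is stable under multiplication by [z]. *)
have Sz_z s: (z * s \in S :\ z)%g = (s \in S :\ z).
  rewrite defS; apply/bigcupP/bigcupP=> -[i _ xiG]; exists i => //;
    by move: xiG; rewrite xG_Z !mem_rcoset -mulgA (groupMl _ Zz).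
have sum_S F : \sum_(s in S) F s =
    F z *+ (z \in S) + \sum_(s in S :\ z) F s :> algC.
  have [Sz | S'z] := boolP (z \in S); first by rewrite (big_setD1 z).
  by rewrite add0r; apply: eq_bigl => s; rewrite !inE;
     case: eqP => [-> | //]; apply: negPf.
pose V := 'rV['F_2]_(2 * n).
have cardV: #|V| = (2 ^ (2 * n))%N by rewrite card_mx card_Fp // mul1n.
(* The left summand indexes the characters, the right one their products with [eps]; the right one
   accounts for the multiplicity [2 ^ (2 * n)] of the last eigenvalue. The term [(z \in S)%:R]
   treats both cases of the theorem at once. *)
pose w (j : V + V) g :=
  match j with inl y => chi phi y g | inr y => eps G g * chi phi y g end.
pose a (j : V + V) : algC :=
  match j with
  | inl y => 4 * (e_count phi x y)%:R - 2 * l%:R + (z \in S)%:R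
  | inr _ => - (z \in S)%:R
  end.
have chi_ortho y1 y2 :
    \sum_(g in G) chi phi y1 g * chi phi y2 g = #|G|%:R *+ (y1 == y2).
  have [-> | neq_y12] := eqVneq y1 y2.
    by under eq_bigr do rewrite chi_sqr; rewrite sumr_const.
  have [|h Gh chi_h] := chi_separates (phi := phi) _ neq_y12.
    by case/isomP: phi_isom.
  (* Translation by the separating element [h] negates each summand. *)
  apply: (sum_antisym (mulgI h)) => g; first by rewrite groupMl.
  by move=> Gg; rewrite !chiM // mulrACA chi_h mulN1r.
have chi_z y g : g \in G -> chi phi y (z * g)%g = chi phi y g.
  by move=> Gg; rewrite chiM // chi_center // mul1r.
have eps_ortho y1 y2 :
    \sum_(g in G) eps G g * chi phi y1 g * chi phi y2 g = 0.
  apply: (sum_antisym (mulgI z)) => g; first by rewrite groupMl.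
  by move=> Gg; rewrite !chi_z // eps_antisym // !mulNr.
have w_ortho j k :
    \sum_(v : subg_of G) w j (sgval v) * w k (sgval v) = #|G|%:R *+ (j == k).
  rewrite (sum_subg G (fun g => w j g * w k g)).
  case: j k => [y1|y1] [y2|y2] /=.
  - exact: chi_ortho.
  - by under eq_bigr do rewrite mulrCA mulrA; apply: eps_ortho.
  - exact: eps_ortho.
  - by under eq_bigr do rewrite mulrACA eps_sqr mul1r; apply: chi_ortho.
have sum_chi y :
    \sum_(s in S :\ z) chi phi y s = 4 * (e_count phi x y)%:R - 2 * l%:R.
  rewrite defS partition_disjoint_bigcup /= => [|i j neq_ij]; last first.
    rewrite -setI_eq0; apply: contraNT neq_ij => /set0Pn[g /setIP[xig xjg]].
    by apply/eqP/xG_inj; rewrite -(class_eqP xig) (class_eqP xjg).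
  (* The character is constant on a class of size 2, whence [2 * (2 * b - 1) = 4 * b - 2] with [b]
     the indicator of a zero dot product. *)
  have sum_xG i : \sum_(s in (x i ^: G)%g) chi phi y s =
      4 * (dot y (phi (coset 'Z(G) (x i))) == 0)%:R - 2.
    under eq_bigr => s xis do rewrite (chiJ phi y (Gx i) xis).
    rewrite sumr_const card_xG /chi sgF2E mulrnBl -mulrnAl.
    by rewrite -mulrnA.
  under eq_bigr do rewrite sum_xG.
  rewrite sumrB -mulr_sumr sumr_const card_ord -(mulr_natr 2 l).
  by rewrite -natr_sum /e_count -sum1dep_card [in RHS]big_mkcond.
have w_eigen j v :
    \sum_(u : subg_of G) w j (sgval u) * (Cay G S u v)%:R = a j * w j (sgval v).
  rewrite sum_Cay //; case: j => y /=.
    rewrite (eq_bigr (fun s => chi phi y s * chi phi y (sgval v))).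
      by rewrite -mulr_suml sum_S sum_chi chi_center // addrC.
    by move=> s Ss; rewrite chiM ?subgP ?(subsetP sSG).
  (* For [eps * chi], the sum over [S :\ z] vanishes by translation by [z]; only the possible term
     at [z] survives. *)
  rewrite sum_S chi_z ?subgP // eps_antisym // (sum_antisym (mulgI z)).
  - by rewrite addr0 !mulNr mulr_natl mulNrn.
  - exact: Sz_z.
  move=> s /setD1P[_ Ss]; have Gs := subsetP sSG _ Ss.
  by rewrite -mulgA chi_z ?groupM ?subgP // eps_antisym // mulNr.
have spec : perm_eq (graph_spectrum (Cay G S)) [seq a j | j <- enum {: V + V}].
  apply: spectrum_orthogonal_eigenbasis w_ortho w_eigen.
    rewrite card_sum cardV -(cardsT (subg_of G)) -(card_isog (isog_subg G)).
    by rewrite G_order addn1 expnS [RHS]mul2n addnn.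
  by rewrite pnatr_eq0 -lt0n cardG_gt0.
have specE : [seq a j | j <- enum {: V + V}] =
    [seq 4 * (e_count phi x y)%:R - 2 * l%:R + (z \in S)%:R | y <- enum {: V}]
    ++ nseq (2 ^ (2 * n)) (- (z \in S)%:R).
  (* The enumeration of a sum type lists the left summand first, matching the two blocks of the
     spectrum. *)
  rewrite enumT unlock /= /sum_enum map_cat -!map_comp; congr (_ ++ _).
  by rewrite -cardV cardE enumT; elim: (Finite.enum V) => //= ? ? ->.
split; last split.
- move=> b; rewrite mem_spectrum (perm_mem spec) => /mapP[[y|y] _ ->] /=.
    by rewrite rpredD ?rpredB ?rpredM ?rpred_nat.
  by rewrite rpredN rpred_nat.
- by move=> Sz; move: spec; rewrite specE Sz.
move=> S'z; move: spec; rewrite specE (negPf S'z) oppr0.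
by under eq_map do rewrite addr0.
Qed.
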